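(* Let $\rho$ be a positive homogeneous polynomial on $\mathbb{C}^2$ such that $u=\log\rho$ is plurisubharmonic and satisfies $(dd^cu)^2=0$ on $\mathbb{C}^2\setminus\{0\}$. Then $\rho$ is a homogeneous polynomial of bidegree $(k,k)$ for some integer $k$ (so that $2k$ is the degree of $\rho$).
   Context: Here $dd^c$ denotes a positive constant multiple of $i\partial\bar\partial$. A homogeneous polynomial on $\mathbb{C}^2$ means a real-valued polynomial in the real coordinates of $\mathbb{C}^2\cong\mathbb{R}^4$ (equivalently in $z_1,z_2,\bar z_1,\bar z_2$) that is homogeneous with respect to real scalars; positive means positive on $\mathbb{C}^2\setminus\{0\}$. It is homogeneous of bidegree $(l,m)$ if it is homogeneous of degree $l$ in $(z_1,z_2)$ and of degree $m$ in $(\bar z_1,\bar z_2)$. *)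

(* Defs.v *)
From HB Require Import structures.
From mathcomp Require Import all_boot all_order all_algebra all_fingroup.
(* mpoly has to be imported before mathcomp-analysis: some notations clash. *)
From mathcomp Require Import mpoly complex.
From mathcomp Require Import all_classical all_reals all_analysis.
Import Order.TTheory GRing.Theory Num.Theory.
Import numFieldNormedType.Exports.

Set Implicit Arguments.
Unset Strict Implicit.
Unset Printing Implicit Defensive.

Local Open Scope classical_set_scope.
Local Open Scope ring_scope.
Local Open Scope complex_scope.

(* C^2 as R^4, with real coordinates (x_1, x_2, y_1, y_2), z_j = x_j + i y_j. *)
Notation C2 R := 'rV[R]_(2 + 2).

(* Real polynomials in (x_1, x_2, y_1, y_2). *)
Notation rpoly R := {mpoly R[2 + 2]}.

(* Complex polynomials in four indeterminates (z_1, z_2, zbar_1, zbar_2). *)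
Notation cpoly R := {mpoly (complex R)[2 + 2]}.

Section ComplexPlane.
Context {R : realType}.
Implicit Types (a b v w x : C2 R) (u : C2 R -> R).

(* Multiplication by i. *)
Definition mulI v : C2 R := row_mx (- rsubmx v) (lsubmx v).

(* Multiplication by the complex number s + i t. *)
Definition cscale (s t : R) v : C2 R := s *: v + t *: mulI v.

Definition usc_on (D : set (C2 R)) u : Prop :=
  forall x, D x -> forall c : R, u x < c -> \forall y \near x, u y < c.

(* Plurisubharmonicity of a real-valued function on an open set D: upper
   semicontinuity and the sub-mean value inequality on every closed complex
   disc { a + zeta b : |zeta| <= 1 } contained in D. *)
Definition plurisubharmonic (D : set (C2 R)) u : Prop :=
  usc_on D u /\
  forall a b,
    (forall s t : R, s ^+ 2 + t ^+ 2 <= 1 -> D (a + cscale s t b)) ->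
    ((u a)%:E <= ((2 * pi)^-1)%:E *
       \int[lebesgue_measure]_(t in `[0%R, (2 * pi)%R])
          (u (a + cscale (cos t) (sin t) b))%:E)%E.

(* Differential forms are given by their values at a point on tangent vectors. *)
Definition form1 := C2 R -> C2 R -> R.
Definition form2 := C2 R -> C2 R -> C2 R -> R.
Definition form4 := C2 R -> ('I_4 -> C2 R) -> R.

(* d^c = i (delbar - del), that is, d^c u = - du o mulI; then
   dd^c = 2 i del delbar. *)
Definition dc u : form1 := fun x v => - 'D_(mulI v) u x.

(* Exterior derivative of a 1-form, evaluated on constant vector fields. *)
Definition ext_d (alpha : form1) : form2 := fun x v w =>
  'D_v (fun y => alpha y w) x - 'D_w (fun y => alpha y v) x.

Definition ddc u : form2 := ext_d (dc u).

Definition wedge (alpha beta : form2) : form4 := fun x vs =>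
  4^-1 * \sum_(s : 'S_4) (-1) ^+ s *
    (alpha x (vs (s (inord 0))) (vs (s (inord 1))) *
     beta x (vs (s (inord 2))) (vs (s (inord 3)))).

Definition vanishes_on (D : set (C2 R)) (omega : form4) : Prop :=
  forall x, D x -> forall vs, omega x vs = 0.

Definition peval (p : rpoly R) x : R := p.@[fun i => x 0 i].

Definition Zvar (j : 'I_2) : cpoly R := 'X_(lshift 2 j).
Definition Zbar (j : 'I_2) : cpoly R := 'X_(rshift 2 j).

(* x_j = (z_j + zbar_j) / 2 and y_j = (z_j - zbar_j) / (2 i). *)
Definition real_coord (i : 'I_(2 + 2)) : cpoly R :=
  match fintype.split i with
  | inl j => 2^-1 *: (Zvar j + Zbar j)
  | inr j => (2 * (0 +i* 1))^-1 *: (Zvar j - Zbar j)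
  end.

(* The expression of a real polynomial in terms of z and zbar. *)
Definition in_zzbar (p : rpoly R) : cpoly R :=
  mmap (fun c : R => (c%:C)%:MP_[2 + 2]) real_coord p.

(* Every monomial has degree l in (z_1, z_2) and degree m in (zbar_1, zbar_2). *)
Definition bihomogeneous (l m : nat) (p : rpoly R) : Prop :=
  forall mu : 'X_{1..2 + 2}, mu \in msupp (in_zzbar p) ->
    (\sum_(j < 2) mu (lshift 2 j) = l)%N /\
    (\sum_(j < 2) mu (rshift 2 j) = m)%N.

End ComplexPlane.

(* Main.v *)
Require Import Defs.
From mathcomp Require Import all_boot all_order all_algebra.
From mathcomp Require Import mpoly complex.
From mathcomp Require Import all_classical all_reals all_analysis.
From mathcomp Require Import ring lra.
Import Order.TTheory GRing.Theory Num.Theory.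
Import numFieldNormedType.Exports.

(** On the complex line through [z <> 0], plurisubharmonicity alone is decisive:
    [log rho (zeta z) - d log |zeta|] is a function [g] of the argument of
    [zeta] only. At a maximum [a] of [g] the sub-mean value inequality on the
    circle [e^{ia} (1 + r e^{it})], together with the vanishing of the mean of
    [log |1 + r e^{it}|], forces [g] to be maximal on the whole circle. For
    [r = sin c] and [t = c + pi / 2] the point [1 + r e^{it}] equals
    [cos c e^{ic}], so [g] is also maximal at [a + c] for every [0 < c < pi / 2],
    hence everywhere. Therefore [rho (e^{it} z) = rho z], and a monomial of
    bidegree [(l, m)] occurring in [rho] satisfies [e^{i (l - m) t} = 1]. *)

Set Implicit Arguments.
Unset Strict Implicit.
Unset Printing Implicit Defensive.

Local Open Scope classical_set_scope.
Local Open Scope ring_scope.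

(* [all_analysis] rebinds [cscale] to the scaling of charges. *)
Local Notation cscale := Defs.cscale.

(** * Primitives on a segment *)

Section Integrals.
Context {R : realType}.
Implicit Types (f g F : R -> R) (a b r t : R).

(** Integrating from [a - 1] leaves a margin around the segment, so that the derivatives of the
    primitive at [a] and [b] are two-sided. *)
Lemma continuous_primitive f a b : a < b -> continuous f ->
  exists F, (forall x, a - 1 < x < b + 1 -> is_derive x 1 F (f x)) /\
    (\int[lebesgue_measure]_(t in `[a, b]) (f t)%:E = (F b - F a)%:E)%E.
Proof.
move=> ab cf.
have fi : lebesgue_measure.-integrable `[a - 1, b + 1] (EFin \o f).
  apply: continuous_compact_integrable; first exact: segment_compact.
  exact: continuous_subspaceT.
pose F x := (\int[lebesgue_measure]_(t in `[a - 1, x]) f t)%R.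
have dF x : a - 1 < x < b + 1 -> is_derive x 1 F (f x).
  move=> /andP[ax xb].
  have [dF F'] := continuous_FTC1_closed xb fi ax (cf x).
  by split; [exact: dF|rewrite -derive1E].
exists F; split=> //.
have cF x : a - 1 < x < b + 1 -> {for x, continuous F}.
  move=> /dF[dFx _]; exact/differentiable_continuous/derivable1_diffP.
rewrite (continuous_FTC2 (F := F)) //.
- exact: continuous_subspaceT.
- split.
  + move=> x; rewrite in_itv /= => /andP[ax xb].
    by have [] // : is_derive x 1 F (f x) by apply: dF; lra.
  + by apply: cvg_at_right_filter; apply: cF; lra.
  + by apply: cvg_at_left_filter; apply: cF; lra.
- move=> x; rewrite in_itv /= => /andP[ax xb].
  have [_ <-] : is_derive x 1 F (f x) by apply: dF; lra.
  by rewrite derive1E.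
Qed.

(** [F] is nondecreasing, so [F b <= F a] makes it constant on the segment. *)
Lemma nonneg_derive_eq0 F f a b :
  (forall x, x \in `[a, b] -> is_derive x 1 F (f x)) ->
  (forall x, x \in `[a, b] -> 0 <= f x) -> F b <= F a ->
  forall x, x \in `]a, b[ -> f x = 0.
Proof.
move=> dF f0 Fba x; rewrite in_itv /= => /andP[ax xb].
have ab : a < b by exact: lt_trans xb.
have Fmono : {in `[a, b]%R &, {homo F : x y / x <= y >-> x <= y}}.
  apply: ger0_derive1_le_cc.
  - move=> y yab; have /dF[] // : y \in `[a, b] by exact: subset_itv_oo_cc.
  - move=> y yab; have yab' : y \in `[a, b] by exact: subset_itv_oo_cc.
    by have [_] := dF _ yab'; rewrite derive1E => ->; exact: f0.
  - apply: derivable_within_continuous => y /dF[]//.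
have Fcst y : y \in `[a, b] -> F y = F a.
  move=> yab; have := yab; rewrite in_itv /= => /andP[ay yb].
  apply/eqP; rewrite eq_le; apply/andP; split.
    by apply: le_trans Fba; apply: Fmono; rewrite // in_itv /= ?lexx ?(ltW ab).
  by apply: Fmono; rewrite // in_itv /= ?lexx ?(ltW ab).
have [_ <-] : is_derive x 1 F (f x) by apply: dF; rewrite in_itv /= !ltW.
have [_ <-] : is_derive x 1 (cst (F a) : R -> R) 0 by exact: is_derive_cst.
apply: near_eq_derive.
near=> y; apply: Fcst; apply: subset_itv_oo_cc.
near: y; apply: near_in_itvoo; rewrite in_itv /= ax xb.
Unshelve. all: by end_near. Qed.

End Integrals.

(** * The mean of log |1 + r e^{it}|^2 *)

Section LogMean.
Context {R : realType}.
Implicit Types (F : R -> R) (a c r t x y : R).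

(* [log |1 + r e^{it}|^2]. *)
Definition log_circle r t : R := ln (1 + 2 * r * cos t + r ^+ 2).

Lemma circle_gt0 r t : -1 < r < 1 -> 0 < 1 + 2 * r * cos t + r ^+ 2.
Proof.
move=> /andP[r1 r2]; have c1 := cos_geN1 t; have c2 := cos_le1 t.
have : 0 < 1 + r * cos t.
  have : `|r * cos t| < 1.
    rewrite normrM (le_lt_trans (ler_piMr _ _)) //.
      by rewrite ler_norml c1.
    by rewrite ltr_norml r1.
  by rewrite ltr_norml => /andP[]; lra.
(* The squared modulus is split into real and imaginary parts; the real part is positive. *)
move=> h; rewrite (_ : _ + _ = (1 + r * cos t) ^+ 2 + r ^+ 2 * sin t ^+ 2).
  by rewrite ltr_wpDr ?exprn_gt0 // mulr_ge0 ?sqr_ge0.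
by rewrite sin2cos2; ring.
Qed.

Lemma is_derive_comp_affine F b c x y : is_derive (b * x + c) 1 F y ->
  is_derive x 1 (fun t => F (b * t + c)) (b * y).
Proof.
move=> dF; have dg : is_derive x 1 (fun t => b * t + c) b.
  have : is_derive x 1 (b \*: id + cst c) (b *: 1 + 0).
    exact: is_deriveD.
  by rewrite addr0 /GRing.scale /= mulr1.
by rewrite mulrC; exact: (is_derive1_comp (g := fun t => b * t + c)).
Qed.

Lemma continuous_log_circle r : -1 < r < 1 -> continuous (log_circle r).
Proof.
move=> r1 t; apply: (@continuous_comp _ _ _ (fun t => 1 + 2 * r * cos t + r ^+ 2)).
  apply: cvgD; last exact: cvg_cst.
  apply: cvgD; first exact: cvg_cst.
  by apply: cvgM; [exact: cvg_cst|exact: continuous_cos].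
exact/continuous_ln/circle_gt0.
Qed.

(* [(1 + r e^{it}) (1 - r e^{it}) = 1 - r^2 e^{2it}]. *)
Lemma log_circle_double r t : -1 < r < 1 ->
  log_circle r t + log_circle r (t + pi) = log_circle (- r ^+ 2) (2 * t).
Proof.
move=> r1; rewrite /log_circle -lnM ?qualifE /= ?circle_gt0 //.
congr ln; rewrite cosDpi (_ : 2 * t = t + t); last by ring.
by have := sin2cos2 t => s2; rewrite cosD -!expr2 s2; ring.
Qed.

(* By the doubling identity, the integral for [r] is half of that for [- r^2];
   iterating it [n] times leaves an integral bounded by [2 pi log 4]. *)
Lemma log_circle_mean_le n r F : -1 < r < 1 ->
  (forall x, -1 < x < 2 * pi + 1 -> is_derive x 1 F (log_circle r x)) ->
  (F (2 * pi) - F 0) * 2 ^+ n <= ln 4 * (2 * pi).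
Proof.
have pi0 := pi_gt0 R.
elim: n r F => [|n IHn] r F r1 dF.
  (* For [n = 0], the mean value theorem and |1 + r e^{it}|^2 <= 4 give the bound. *)
  have [] := @MVT _ F (log_circle r) 0 (2 * pi).
  - by rewrite mulr_gt0.
  - by move=> x; rewrite in_itv /= => /andP[x0 x1]; apply: dF; lra.
  - apply: derivable_within_continuous => x; rewrite in_itv /= => /andP[x0 x1].
    by have [] : is_derive x 1 F (log_circle r x) by apply: dF; lra.
  move=> c _ ->; rewrite subr0 mulr1 ler_wpM2r ?mulr_ge0 ?pi_ge0 //.
  rewrite /log_circle ler_ln ?qualifE /= ?circle_gt0 //.
  have := cos_geN1 c; have := cos_le1 c; nra.
have r2 : -1 < - r ^+ 2 < 1 by nra.
have [G [dG _]] : exists G, (forall x, 0 - 1 < x < 2 * pi + 1 ->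
    is_derive x 1 G (log_circle (- r ^+ 2) x)) /\ _ :=
  continuous_primitive (mulr_gt0 (ltr0n _ 2) pi0) (continuous_log_circle r2).
rewrite add0r in dG.
have := IHn _ _ r2 dG.
(* By the doubling identity [K] is constant on [0, pi]. In [K pi = K 0] the term [F pi] cancels, and
   [F (2 * pi) - F 0] is half of [G (2 * pi) - G 0]. *)
pose K t := F t + F (t + pi) - 2^-1 * G (2 * t).
have dK x : x \in `[0, pi] -> is_derive x 1 K 0.
  rewrite in_itv /= => /andP[x0 x1].
  have dF1 : is_derive x 1 F (log_circle r x) by apply: dF; lra.
  have dF2 : is_derive (x + pi) 1 F (log_circle r (x + pi)) by apply: dF; lra.
  have dG2 : is_derive (2 * x) 1 G (log_circle (- r ^+ 2) (2 * x)).
    by apply: dG; lra.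
  have dF3 : is_derive x 1 (fun t => F (t + pi)) (log_circle r (x + pi)).
    under eq_fun do rewrite -[X in X + _]mul1r.
    by rewrite -[log_circle _ _]mul1r; apply: is_derive_comp_affine; rewrite mul1r.
  have dG3 : is_derive x 1 (fun t => G (2 * t)) (2 * log_circle (- r ^+ 2) (2 * x)).
    under eq_fun do rewrite -[X in G X]addr0.
    by apply: is_derive_comp_affine; rewrite addr0.
  have : is_derive x 1 K _ := is_deriveB (is_deriveD dF1 dF3) (is_deriveZ 2^-1 dG3).
  by rewrite -(log_circle_double x r1) scalerA mulVf ?scale1r ?subrr.
have KE : K pi - K 0 = 0.
  have H1 x : x \in `]0, pi[%R -> is_derive x 1 K 0.
    by move=> x_itv; apply: dK; exact: subset_itv_oo_cc.
  have H2 : {within `[0, pi], continuous K}.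
    by apply: derivable_within_continuous => x /dK[].
  by have [c _ ->] := MVT pi0 H1 H2; rewrite mul0r.
move: KE; rewrite /K mulr0 add0r exprS => E IH.
rewrite (_ : _ * _ = (G (2 * pi) - G 0) * 2 ^+ n) //.
rewrite mulrA; congr (_ * _); move: E.
rewrite (_ : pi + pi = 2 * pi :> R); last by ring.
by lra.
Qed.

(** The bound of [log_circle_mean_le] is the same for all [n], while a positive difference times
    [2 ^+ n] is unbounded. *)
Lemma log_circle_mean_le0 r F : -1 < r < 1 ->
  (forall x, -1 < x < 2 * pi + 1 -> is_derive x 1 F (log_circle r x)) ->
  F (2 * pi) <= F 0.
Proof.
move=> r1 dF; rewrite leNgt; apply/negP => lt.
have D0 : 0 < F (2 * pi) - F 0 by rewrite subr_gt0.
pose n := Num.bound ((F (2 * pi) - F 0)^-1 * (ln 4 * (2 * pi))).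
have := log_circle_mean_le n r1 dF; apply/negP; rewrite -ltNge.
rewrite -ltr_pdivrMl //; apply: (lt_trans (archi_boundP _)).
  by rewrite !mulr_ge0 ?invr_ge0 ?ln_ge0 ?pi_ge0 ?ler1n // ltW.
by rewrite -natrX ltr_nat ltn_expl.
Qed.

(** The majorant has mean at most [M], and [H] has mean at least [M]; their nonnegative continuous
    difference therefore vanishes. *)
Lemma submean_log_circle (H : R -> R) M k r : continuous H -> 0 <= k ->
  -1 < r < 1 -> (forall t, H t <= M + k * log_circle r t) ->
  (M%:E <= ((2 * pi)^-1)%:E *
     \int[lebesgue_measure]_(t in `[0%R, (2 * pi)%R]) (H t)%:E)%E ->
  forall t, t \in `]0, (2 * pi)[ -> H t = M + k * log_circle r t.
Proof.
have pi0 := pi_gt0 R; have pi20 : 0 < 2 * pi :> R by rewrite mulr_gt0.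
move=> cH k0 r1 Hle.
have [F [dF _]] := continuous_primitive pi20 (continuous_log_circle r1).
have [G [dG ->]] := continuous_primitive pi20 cH.
rewrite add0r in dF dG; rewrite -EFinM lee_fin mulrC ler_pdivlMr // => MG.
have F0 := log_circle_mean_le0 r1 dF.
move=> t t0; apply/eqP; rewrite eq_sym -subr_eq0; apply/eqP.
(* A primitive of majorant minus [H]; the two mean inequalities give [P (2 * pi) <= P 0]. *)
pose P t := t * M + k * F t - G t.
have dP x : x \in `[0, (2 * pi)] ->
    is_derive x 1 P (M + k * log_circle r x - H x).
  rewrite in_itv /= => /andP[x0 x1].
  have dFx : is_derive x 1 F (log_circle r x) by apply: dF; lra.
  have dGx : is_derive x 1 G (H x) by apply: dG; lra.
  have : is_derive x 1 P _ := is_deriveB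
    (is_deriveD (is_deriveM (is_derive_id x 1) (is_derive_cst M x 1))
      (is_deriveZ k dFx)) dGx.
  by rewrite /= scaler0 add0r scaler1.
apply: (nonneg_derive_eq0 dP) => //.
- by move=> x _; rewrite subr_ge0.
- by rewrite /P mul0r add0r; nra.
Qed.

(** * Polar coordinates and propagation of the maximum *)

Lemma cos_sin_neq0 a : (cos a, sin a) != (0, 0) :> R * R.
Proof.
apply/eqP => -[c0 s0]; have := cos2Dsin2 a.
by rewrite c0 s0 expr0n addr0 => /eqP; rewrite eq_sym oner_eq0.
Qed.

(** The angle is [acos (x / l)] or its opposite, according to the sign of [y]. Its range is the
    segment on which the angular function is maximised below. *)
Lemma polar_coord (x y : R) : (x, y) != (0, 0) -> exists l a,
  [/\ 0 < l, a \in `[(- pi), pi], x = l * cos a & y = l * sin a].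
Proof.
move=> xy0; have n0 : 0 < x ^+ 2 + y ^+ 2.
  rewrite lt_neqAle addr_ge0 ?sqr_ge0 // andbT eq_sym paddr_eq0 ?sqr_ge0 //.
  by rewrite !sqrf_eq0 -xpair_eqE.
pose l := Num.sqrt (x ^+ 2 + y ^+ 2).
have l0 : 0 < l by rewrite sqrtr_gt0.
have l2 : l ^+ 2 = x ^+ 2 + y ^+ 2 by rewrite sqr_sqrtr ?ltW.
have xl : -1 <= x / l <= 1.
  rewrite -ler_norml normf_div (gtr0_norm l0) ler_pdivrMr // mul1r.
  by rewrite -sqrtr_sqr ler_wsqrtr // lerDl sqr_ge0.
have s : sin (acos (x / l)) = `|y| / l.
  rewrite sin_acos // (_ : 1 - _ = (y / l) ^+ 2).
    by rewrite sqrtr_sqr normf_div (gtr0_norm l0).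
  rewrite !expr_div_n l2; field; exact: lt0r_neq0.
have c : cos (acos (x / l)) = x / l by rewrite acosK.
have a0 := acos_ge0 xl; have api := acos_lepi xl; have pi0 := pi_gt0 R.
have [y0|y0] := leP 0 y.
  exists l, (acos (x / l)); rewrite s c ger0_norm // ![l * _]mulrC !divfK ?gt_eqF //.
  by split => //; rewrite in_itv /=; apply/andP; split=> //; lra.
exists l, (- acos (x / l)); rewrite sinN cosN s c ltr0_norm // mulNr opprK.
rewrite ![l * _]mulrC !divfK ?gt_eqF //.
by split => //; rewrite in_itv /=; apply/andP; split=> //; lra.
Qed.

(* Real and imaginary part of [e^{ia} (1 + r e^{it})]. *)
Definition circle_x a r t : R := (1 + r * cos t) * cos a - r * sin t * sin a.
Definition circle_y a r t : R := (1 + r * cos t) * sin a + r * sin t * cos a.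

Lemma circle_xy_norm a r t :
  circle_x a r t ^+ 2 + circle_y a r t ^+ 2 = 1 + 2 * r * cos t + r ^+ 2.
Proof.
have ca : cos a ^+ 2 = 1 - sin a ^+ 2 := cos2sin2 a.
have ct : cos t ^+ 2 = 1 - sin t ^+ 2 := cos2sin2 t.
by rewrite /circle_x /circle_y; ring: ca ct.
Qed.

Lemma circle_xy_neq0 a r t : -1 < r < 1 ->
  (circle_x a r t, circle_y a r t) != (0, 0).
Proof.
move=> r1; apply/eqP => -[X0 Y0]; have := circle_gt0 t r1.
by rewrite -(circle_xy_norm a) X0 Y0 expr0n addr0 ltxx.
Qed.

Lemma circle_xy_cont a r : continuous (circle_x a r) * continuous (circle_y a r).
Proof.
have c1 : continuous (fun t => 1 + r * cos t).
  move=> t; apply: cvgD; first exact: cvg_cst.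
  by apply: cvgM; [exact: cvg_cst|exact: continuous_cos].
have c2 : continuous (fun t => r * sin t).
  by move=> t; apply: cvgM; [exact: cvg_cst|exact: continuous_sin].
split=> t.
  by apply: cvgB; apply: cvgM; [exact: c1|exact: cvg_cst|exact: c2|exact: cvg_cst].
by apply: cvgD; apply: cvgM; [exact: c1|exact: cvg_cst|exact: c2|exact: cvg_cst].
Qed.

(** [L] abstracts log rho on a complex line; [k] is half the degree, since [log_circle] is the
    logarithm of a squared modulus. *)
Lemma log_homog_circle_cst (L : R -> R -> R) (k : R) : 0 <= k ->
  (forall l x y, 0 < l -> (x, y) != (0, 0) ->
    L (l * x) (l * y) = k * ln (l ^+ 2) + L x y) ->
  (forall X Y : R -> R, continuous X -> continuous Y ->
    (forall t, (X t, Y t) != (0, 0)) -> continuous (fun t => L (X t) (Y t))) ->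
  (forall a r, 0 < r < 1 ->
    ((L (cos a) (sin a))%:E <= ((2 * pi)^-1)%:E *
      \int[lebesgue_measure]_(t in `[0%R, (2 * pi)%R])
        (L (circle_x a r t) (circle_y a r t))%:E)%E) ->
  forall a, 0 <= a <= pi -> L (cos a) (sin a) = L 1 0.
Proof.
move=> k_ge0 L_homog L_cont L_submean a.
pose g b := L (cos b) (sin b).
have pi0 := pi_gt0 R.
have gcont : continuous g.
  apply: L_cont; [exact: continuous_cos|exact: continuous_sin|] => t.
  exact: cos_sin_neq0.
have [|m mpi gm] := @EVT_max _ g (- pi) pi _ (continuous_subspaceT gcont).
  by lra.
have step b c : g b = g m -> 0 < c < pi / 2 -> g (b + c) = g m.
  move=> gb c_itv; have c0 := sin_gt0_pihalf c_itv.
  have cc0 : 0 < cos c by apply: cos_gt0_pihalf; case/andP: c_itv => *; lra.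
  have cs := cos2Dsin2 c.
  have sc1 : -1 < sin c < 1 by nra.
  have H_le t : L (circle_x b (sin c) t) (circle_y b (sin c) t) <=
      g m + k * log_circle (sin c) t.
    (* With polar coordinates [l], [e] of the circle point, homogeneity turns the left side into
       [k * ln (l ^+ 2) + g e], and [g e <= g m] since [e] lies in [-pi, pi]. *)
    have := circle_xy_norm b (sin c) t.
    have [l [e [l0 epi -> ->]]] := polar_coord (circle_xy_neq0 b t sc1).
    rewrite /log_circle => <-; rewrite L_homog ?cos_sin_neq0 // addrC.
    rewrite (_ : (_ * _) ^+ 2 + _ = l ^+ 2) ?lerD2r ?gm //.
    by have := cos2sin2 e => ce; ring: ce.
  have := @submean_log_circle _ (g m) k (sin c) _ k_ge0 sc1 H_le _ (c + pi / 2).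
  have -> : circle_x b (sin c) (c + pi / 2) = cos c * cos (b + c).
    by rewrite /circle_x cosDpihalf sinDpihalf cosD; have := sin2cos2 c => e; ring: e.
  have -> : circle_y b (sin c) (c + pi / 2) = cos c * sin (b + c).
    by rewrite /circle_y cosDpihalf sinDpihalf sinD; have := sin2cos2 c => e; ring: e.
  rewrite L_homog ?cos_sin_neq0 // /log_circle cosDpihalf.
  rewrite (_ : 1 + _ + _ = cos c ^+ 2); last first.
    by have := cos2sin2 c => e; ring: e.
  (* The pointwise equality now reads [k * ln (cos c ^+ 2) + g (b + c) = g m + k * ln (cos c ^+
     2)]. *)
  move=> H; apply: (addrI (k * ln (cos c ^+ 2))); rewrite [RHS]addrC; apply: H.
  - have [cX cY] := circle_xy_cont b (sin c).
    by apply: (L_cont _ _ cX cY) => t; exact: circle_xy_neq0.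
  - by rewrite -gb; apply: L_submean; rewrite c0; case/andP: sc1.
  - by rewrite in_itv /=; case/andP: c_itv => *; apply/andP; split; lra.
have steps n c : 0 < c < pi / 2 -> g (m + c *+ n) = g m.
  move=> c_itv; elim: n => [|n IHn]; first by rewrite mulr0n addr0.
  by rewrite mulrSr addrA; apply: step.
(* Sixteen steps of length less than [pi / 2] suffice, since [4 pi < 16]. *)
have far c : m < c < m + 16 -> g c = g m.
  move=> /andP[mc cm]; have := @steps 16 ((c - m) / 16).
  rewrite -[X in m + X]mulr_natr divfK // [m + _]addrC subrK; apply.
  by have := pihalf_ge1 R; have := pihalf_lt2 R; lra.
have gper b : g (b + pi *+ 2) = g b by rewrite /g cosD2pi sinD2pi.
move: mpi; rewrite in_itv /= => /andP[m1 m2] /andP[a0 a1].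
have pi4 := pihalf_lt2 R.
have -> : L 1 0 = g 0 by rewrite /g cos0 sin0.
(* Since [m <= pi], adding 2 pi moves both angles strictly beyond [m], at distance at most 4 pi. *)
rewrite -[LHS]/(g a) -[LHS]gper -[RHS]gper.
by rewrite !far //; lra.
Qed.

End LogMean.

(** * Polynomial functions and substitutions *)

Lemma poly_horner_eq0 (R : numDomainType) (p : {poly R}) :
  (forall c, p.[c] = 0) -> p = 0.
Proof.
move=> p0; apply/eqP; apply: contraT => pn0.
(* The integers 0, ..., [size p - 1] are distinct, and one root too many for a nonzero [p]. *)
have := @max_poly_roots _ p [seq i%:R | i <- iota 0 (size p)] pn0.
rewrite size_map size_iota ltnn; apply.
  by apply/allP => x _; apply/rootP.
rewrite map_inj_uniq ?iota_uniq //; exact: mulrIn (oner_neq0 _).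
Qed.

(** Makes [muni], the view of [p] as a univariate polynomial in the last variable, usable for
    induction on the number of variables. *)
Lemma mcoeff_muni (R : nzRingType) n (p : {mpoly R[n.+1]}) (m : 'X_{1..n.+1}) :
  ((muni p)`_(m ord_max))@_[multinom m (widen_ord (leqnSn n) i) | i < n] = p@_m.
Proof.
rewrite muniE coef_sum raddf_sum [in RHS](mpolyE p) raddf_sum.
apply: eq_bigr => m' _ /=; rewrite !coefZ coefXn mulr_natr mcoeffMn !mcoeffZ.
rewrite !mcoeffX -mulrnAr -mulrnA mulnb; congr (_ * _%:R); congr nat_of_bool.
apply/andP/eqP => [[/eqP/mnmP mE /eqP m_max]|->]; last by rewrite !eqxx.
apply/mnmP => i; case: (unliftP ord_max i) => [j|] -> //.
have := mE j; rewrite !mnmE; congr (m' _ = m _); apply: val_inj;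
  by rewrite /= /bump leqNgt ltn_ord.
Qed.

Lemma mpoly_meval_eq0 (R : numDomainType) n (p : {mpoly R[n]}) :
  (forall v, p.@[v] = 0) -> p = 0.
Proof.
elim: n p => [|n IHn] p p0.
  have pC : p = (p@_0)%:MP.
    apply/mpolyP => m; rewrite mcoeffC (_ : m = 0%MM) ?eqxx ?mulr1 //.
    by apply/mnmP => -[].
  have := p0 (fun=> 0); rewrite {1}pC mevalC => pz.
  by rewrite pC pz mpolyC0.
suff mp0 : muni p = 0.
  by apply/mpolyP => m; rewrite -mcoeff_muni mp0 coef0 !mcoeff0.
apply/polyP => i; rewrite coef0; apply: IHn => v.
(* Fixing the first [n] variables at [v] leaves a univariate polynomial that vanishes at every value
   [c] of the last one. *)
have : map_poly (meval v) (muni p) = 0.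
  apply: poly_horner_eq0 => c.
  pose w (j : 'I_n.+1) := oapp v c (unlift ord_max j).
  rewrite -(p0 w) mevalE muniE rmorph_sum horner_sum.
  apply: eq_bigr => m _ /=.
  rewrite !map_polyZ /= map_polyXn !hornerZ hornerXn mevalZ mevalX -mulrA.
  congr (_ * _); rewrite big_ord_recr /= /w unlift_none /=; congr (_ * _).
  apply: eq_bigr => j _; rewrite mnmE; congr (_ ^+ _).
  have -> : widen_ord (leqnSn n) j = lift ord_max j.
    by apply: val_inj; rewrite /= /bump leqNgt ltn_ord.
  by rewrite liftK.
by move/(congr1 (fun q : {poly R} => q`_i)); rewrite coef_map coef0.
Qed.

Lemma eq_mmap (R S : nzRingType) n (f : R -> S) (h1 h2 : 'I_n -> S)
    (p : {mpoly R[n]}) : h1 =1 h2 -> mmap f h1 p = mmap f h2 p.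
Proof. by move=> h12; apply: eq_bigr => m _; rewrite (mmap1_eq m h12). Qed.

(** Handles a substitution made before a change of coordinates; [comp_mpoly_mmap] handles one made
    after it. Together they reduce polynomial identities to generators. *)
Lemma mmap_comp_mpoly (R : comNzRingType) (S : comNzRingType) n k
    (f : {rmorphism R -> S}) (h : 'I_k -> S)
    (p : {mpoly R[n]}) (lq : n.-tuple {mpoly R[k]}) :
  mmap f h (p \mPo lq) = mmap f (fun i => mmap f h (tnth lq i)) p.
Proof.
rewrite comp_mpolyE raddf_sum; apply: eq_bigr => m _.
rewrite /= mmapZ rmorph_prod; congr (_ * _).
by apply: eq_bigr => i _; rewrite rmorphXn.
Qed.

Lemma comp_mpoly_mmap (R S : comNzRingType) n k l
    (f : {rmorphism R -> S}) (h : 'I_n -> {mpoly S[k]})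
    (p : {mpoly R[n]}) (lq : k.-tuple {mpoly S[l]}) :
  mmap (fun c => (f c)%:MP) h p \mPo lq =
  mmap (fun c => (f c)%:MP) (fun i => h i \mPo lq) p.
Proof.
rewrite /mmap raddf_sum; apply: eq_bigr => m _.
rewrite /= rmorphM /= comp_mpolyC rmorph_prod; congr (_ * _).
by apply: eq_bigr => i _; rewrite rmorphXn.
Qed.

Definition scale_vars (R : comNzRingType) n (w : 'I_n -> R) :
  n.-tuple {mpoly R[n]} := [tuple w i *: 'X_i | i < n].

(** A diagonal substitution does not mix monomials. *)
Lemma mcoeff_comp_scale (R : comNzRingType) n (w : 'I_n -> R)
    (p : {mpoly R[n]}) m :
  (p \mPo scale_vars w)@_m = (\prod_i w i ^+ m i) * p@_m.
Proof.
rewrite comp_mpolyE raddf_sum [in RHS](mpolyE p) raddf_sum mulr_sumr.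
apply: eq_bigr => m' _ /=.
under eq_bigr do rewrite tnth_mktuple exprZn.
rewrite scaler_prod -mpolyXE_id !mcoeffZ mcoeffX.
by have [->|_] := eqVneq m' m; rewrite ?mulr1 ?mulr0 // mulrC.
Qed.

(** * Complex scaling acts diagonally in z and zbar *)

Section ComplexScaling.
Local Open Scope complex_scope.
Context {R : realType}.
Implicit Types (c s k : R) (x : C2 R) (p : rpoly R).

Definition cscale_vars c s : (2 + 2).-tuple (rpoly R) :=
  [tuple match fintype.split i with
         | inl j => c *: 'X_(lshift 2 j) - s *: 'X_(rshift 2 j)
         | inr j => c *: 'X_(rshift 2 j) + s *: 'X_(lshift 2 j)
         end | i < 2 + 2].

Lemma cscale_lshift c s x j :
  cscale c s x 0 (lshift 2 j) = c * x 0 (lshift 2 j) - s * x 0 (rshift 2 j).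
Proof. by rewrite /cscale /mulI !mxE (unsplitK (inl j)) /= !mxE mulrN. Qed.

Lemma cscale_rshift c s x j :
  cscale c s x 0 (rshift 2 j) = c * x 0 (rshift 2 j) + s * x 0 (lshift 2 j).
Proof. by rewrite /cscale /mulI !mxE (unsplitK (inr j)) /= !mxE. Qed.

Lemma peval_cscale_vars c s p x : peval (p \mPo cscale_vars c s) x = peval p (cscale c s x).
Proof.
rewrite /peval comp_mpoly_meval; apply: meval_eq => i.
rewrite tnth_mktuple -[in RHS](splitK i); case: (fintype.split i) => j /=.
  by rewrite cscale_lshift mevalB !mevalZ !mevalXU.
by rewrite cscale_rshift mevalD !mevalZ !mevalXU.
Qed.

Lemma peval_eq0 p : (forall x, peval p x = 0) -> p = 0.
Proof.
move=> p0; apply: mpoly_meval_eq0 => v; rewrite -(p0 (\row_i v i)).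
by apply: meval_eq => i; rewrite mxE.
Qed.

Definition zscale c s (i : 'I_(2 + 2)) : R[i] :=
  if fintype.split i is inl _ then c +i* s else c -i* s.

(** It suffices to compare both sides on the real coordinates, where z_j is multiplied by c + i s
    and zbar_j by its conjugate. *)
Lemma in_zzbar_cscale_vars c s p :
  in_zzbar (p \mPo cscale_vars c s) =
  in_zzbar p \mPo scale_vars (zscale c s).
Proof.
pose f : {rmorphism R -> cpoly R} := (@mpolyC (2 + 2) R[i] \o real_complex R).
rewrite /in_zzbar comp_mpoly_mmap (@mmap_comp_mpoly _ _ _ _ f).
apply: eq_mmap => i.
have iV : (2 * (0 +i* 1))^-1 = - 'i * 2^-1 :> R[i].
  by rewrite invfM mulrC; congr (_ * _); rewrite complexiE invCi.
have hE (j : 'I_2) : (real_coord (lshift 2 j) =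
    (2^-1)%:MP * ('X_(lshift 2 j) + 'X_(rshift 2 j)) :> cpoly R) *
    (real_coord (rshift 2 j) =
    (- 'i)%:MP * (2^-1)%:MP * ('X_(lshift 2 j) - 'X_(rshift 2 j)) :> cpoly R).
  rewrite /real_coord (unsplitK (inl j)) (unsplitK (inr j)) iV -mpolyCM.
  by rewrite !mul_mpolyC.
have ii : ('i)%:MP * ('i)%:MP = -1 :> cpoly R.
  by rewrite -mpolyCM -expr2 sqr_i mpolyCN mpolyC1.
have zE (j : 'I_2) :
    ('X_(lshift 2 j) \mPo scale_vars (zscale c s) =
      ((c%:C)%:MP + ('i)%:MP * (s%:C)%:MP) * 'X_(lshift 2 j) :> cpoly R) *
    ('X_(rshift 2 j) \mPo scale_vars (zscale c s) =
      ((c%:C)%:MP - ('i)%:MP * (s%:C)%:MP) * 'X_(rshift 2 j) :> cpoly R).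
  rewrite !comp_mpolyXU -!tnth_nth !tnth_mktuple /zscale.
  rewrite (unsplitK (inl j)) (unsplitK (inr j)) -mpolyCM -mpolyCD -mpolyCB.
  rewrite !mul_mpolyC; split; congr (_ *: _);
    by apply/eqP; rewrite eq_complex /=; apply/andP; split; apply/eqP; ring.
rewrite tnth_mktuple -(splitK i); case: (fintype.split i) => j; rewrite unsplitK /=.
  rewrite mmapB !(mmapZ _ f) !mmapX !mmap1U !hE rmorphM /= comp_mpolyC comp_mpolyD.
  rewrite !zE mpolyCN /=; ring.
rewrite mmapD !(mmapZ _ f) !mmapX !mmap1U !hE !rmorphM /= !comp_mpolyC comp_mpolyB.
rewrite !zE mpolyCN /=; ring: ii.
Qed.

Lemma mcoeff_in_zzbar_cscale_vars c s p m :
  (in_zzbar (p \mPo cscale_vars c s))@_m =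
  (\prod_i zscale c s i ^+ m i) * (in_zzbar p)@_m.
Proof. by rewrite -(mcoeff_comp_scale (zscale c s) (in_zzbar p)) in_zzbar_cscale_vars. Qed.

Lemma in_zzbarZ k p : in_zzbar (k *: p) = (k%:C)%:MP * in_zzbar p.
Proof. exact: (mmapZ _ (@mpolyC (2 + 2) R[i] \o real_complex R)). Qed.

(** The eigenvalue equation holds between polynomials, so coefficients can be compared and a nonzero
    one cancelled. It serves for a dilation and for a rotation. *)
Lemma mcoeff_in_zzbar_eigen c s k p :
  (forall x, peval p (cscale c s x) = k * peval p x) ->
  forall m, m \in msupp (in_zzbar p) ->
  (c +i* s) ^+ (\sum_(j < 2) m (lshift 2 j)) *
  (c -i* s) ^+ (\sum_(j < 2) m (rshift 2 j)) = k%:C.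
Proof.
move=> pk m mp.
have pE : p \mPo cscale_vars c s = k *: p.
  apply/eqP; rewrite -subr_eq0; apply/eqP/peval_eq0 => x.
  by rewrite /peval mevalB mevalZ -!/(peval _ _) peval_cscale_vars pk subrr.
have : \prod_i zscale c s i ^+ m i * (in_zzbar p)@_m = k%:C * (in_zzbar p)@_m.
  by rewrite -mcoeff_in_zzbar_cscale_vars pE in_zzbarZ mcoeffCM.
move: mp; rewrite mcoeff_msupp => mp /(mulIf mp) <-.
rewrite big_split_ord /= /zscale; congr (_ * _).
  rewrite expr_sum; apply: eq_bigr => j _.
  by rewrite -[lshift _ _]/(unsplit (inl j)) unsplitK.
rewrite expr_sum; apply: eq_bigr => j _.
by rewrite -[rshift _ _]/(unsplit (inr j)) unsplitK.
Qed.

Definition cis (t : R) : R[i] := cos t +i* sin t.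

Lemma cisD t u : cis (t + u) = cis t * cis u.
Proof. by rewrite /cis cosD sinD; congr (_ +i* _); rewrite addrC. Qed.

Lemma cisX t n : cis t ^+ n = cis (t *+ n).
Proof.
elim: n => [|n IHn]; first by rewrite expr0 mulr0n /cis cos0 sin0.
by rewrite exprS IHn mulrS cisD.
Qed.

Lemma cisN t : cis (- t) = cos t -i* sin t.
Proof. by rewrite /cis cosN sinN. Qed.

(* [l - m] is read off from the action of a rotation whose angle is too small
   to have [(l - m) t] a non-zero multiple of [pi]. *)
Lemma cis_balanced (d l m : nat) : (l + m = d)%N ->
  let t : R := pi / d.+1%:R in
  cis t ^+ l * cis (- t) ^+ m = 1 -> l = m.
Proof.
move=> lmd t; rewrite !cisX -cisD => -[_].
have tgt0 : 0 < t by rewrite divr_gt0 ?pi_gt0.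
have small n : (0 < n <= d)%N -> 0 < sin (t *+ n).
  case/andP=> n0 nd; apply: sin_gt0_pi; rewrite mulrn_wgt0 //=.
  by rewrite -mulr_natr /t mulrAC ltr_pdivrMr // n0 ltr_pM2l ?pi_gt0 // ltr_nat.
case: (ltngtP l m) => // [lm|ml].
  have -> : t *+ l + - t *+ m = - (t *+ (m - l)).
    by rewrite mulrnBr ?(ltnW lm) // opprB mulNrn.
  rewrite sinN => /eqP; rewrite oppr_eq0 gt_eqF // small //.
  by rewrite subn_gt0 lm -lmd (leq_trans (leq_subr _ _)) ?leq_addl.
rewrite mulNrn -mulrnBr ?(ltnW ml) // => /eqP; rewrite gt_eqF // small //.
by rewrite subn_gt0 ml -lmd (leq_trans (leq_subr _ _)) ?leq_addr.
Qed.

End ComplexScaling.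

(** * Restriction to a complex line and rotation invariance *)

Section Line.
Context {R : realType}.
Implicit Types (a b l s t : R) (x : C2 R) (rho : rpoly R).

Lemma cscaleM a b s t x :
  cscale a b (cscale s t x) = cscale (a * s - b * t) (a * t + b * s) x.
Proof.
apply/rowP => i; rewrite -(splitK i); case: (fintype.split i) => j /=;
  by rewrite ?(cscale_lshift, cscale_rshift); ring.
Qed.

Lemma cscale_real l x : cscale l 0 x = l *: x.
Proof. by rewrite /cscale scale0r addr0. Qed.

Lemma cscale_neq0 s t x : (s, t) != (0, 0) -> x != 0 -> cscale s t x != 0.
Proof.
move=> st0 x0; apply: contraNneq st0 => stx0.
(* Multiplication by the conjugate scalar. *)
have : cscale s (- t) (cscale s t x) = (s ^+ 2 + t ^+ 2) *: x.
  by rewrite cscaleM -cscale_real; congr (cscale _ _ _); ring.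
rewrite stx0 -[0 in LHS](scale0r x) -cscale_real cscaleM !mulr0 subrr addr0.
rewrite cscale_real scale0r => /esym/eqP.
rewrite scaler_eq0 (negbTE x0) orbF paddr_eq0 ?sqr_ge0 //.
by rewrite !sqrf_eq0 xpair_eqE.
Qed.

Lemma peval_scale d rho l x : rho \is d.-homog ->
  peval rho (l *: x) = l ^+ d * peval rho x.
Proof.
move=> /dhomogP rho_d; rewrite /peval !mevalE mulr_sumr.
apply: eq_big_seq => m /rho_d /= <-.
rewrite mulrCA; congr (_ * _).
rewrite mdegE expr_sum -big_split; apply: eq_bigr => i _.
by rewrite mxE exprMn.
Qed.

Lemma continuous_peval rho (f : R -> C2 R) :
  (forall i, continuous (fun t => f t 0 i)) -> continuous (fun t => peval rho (f t)).
Proof.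
move=> cf; rewrite /peval; under eq_fun do rewrite mevalE.
apply: continuous_big => [|m _]; first exact: add_continuous.
move=> t; apply: cvgM; first exact: cvg_cst.
move: t; rewrite -/(continuous _).
apply: continuous_big => [|i _]; first exact: mul_continuous.
move=> t; apply: (@continuous_comp _ _ _ (fun t => f t 0 i) (fun y => y ^+ m i)).
  exact: cf.
exact: exprn_continuous.
Qed.

Lemma continuous_cscale x (X Y : R -> R) i : continuous X -> continuous Y ->
  continuous (fun t => cscale (X t) (Y t) x 0 i).
Proof.
move=> cX cY; rewrite -(splitK i); case: (fintype.split i) => j /=.
  under eq_fun do rewrite cscale_lshift.
  by move=> t; apply: cvgB; apply: cvgM;
    [exact: cX|exact: cvg_cst|exact: cY|exact: cvg_cst].
under eq_fun do rewrite cscale_rshift.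
by move=> t; apply: cvgD; apply: cvgM;
  [exact: cX|exact: cvg_cst|exact: cY|exact: cvg_cst].
Qed.

Lemma psh_log_rotation_invariant d rho :
  rho \is d.-homog -> (forall x, x != 0 -> 0 < peval rho x) ->
  plurisubharmonic (~` [set 0 : C2 R]) (fun x => ln (peval rho x)) ->
  forall a x, 0 <= a <= pi -> peval rho (cscale (cos a) (sin a) x) = peval rho x.
Proof.
move=> rho_d rho_pos [_ sub] a x a_itv.
have [->|x0] := eqVneq x 0.
  by rewrite -[0 in LHS](scale0r 0) -cscale_real cscaleM !mulr0 subrr addr0
    cscale_real scale0r.
have pos s t : (s, t) != (0, 0) -> 0 < peval rho (cscale s t x).
  by move=> st; apply/rho_pos/cscale_neq0.
pose L s t := ln (peval rho (cscale s t x)).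
suff E : L (cos a) (sin a) = L 1 0.
  move: E; rewrite /L cscale_real scale1r => /ln_inj; apply; rewrite qualifE /=.
    exact/pos/cos_sin_neq0.
  exact: rho_pos.
apply: (@log_homog_circle_cst _ L (d%:R / 2)) => //.
- move=> l s t l0 st; rewrite /L.
  rewrite (_ : cscale (l * s) (l * t) x = l *: cscale s t x); last first.
    by rewrite -cscale_real cscaleM; congr (cscale _ _ _); ring.
  rewrite (peval_scale _ _ rho_d) lnM ?qualifE /= ?exprn_gt0 ?pos //.
  by rewrite !lnXn // -[ln l *+ d]mulr_natl -[ln l *+ 2]mulr_natl; field.
- move=> X Y cX cY XY t.
  apply: (@continuous_comp _ _ _ (fun t => peval rho (cscale (X t) (Y t) x))).
    by apply: continuous_peval => i; exact: continuous_cscale.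
  exact/continuous_ln/pos.
- move=> b r /andP[r0 r1].
  (* The disc has centre e^{ib} x and direction r e^{ib} x, so its points are e^{ib} (1 + r (s + i
     t)) x. *)
  have shift s t :
      cscale (cos b) (sin b) x + cscale s t (r *: cscale (cos b) (sin b) x) =
      cscale ((1 + r * s) * cos b - r * t * sin b)
             ((1 + r * s) * sin b + r * t * cos b) x.
    apply/rowP => i; rewrite -cscale_real !cscaleM mxE -(splitK i).
    by case: (fintype.split i) => j /=; rewrite !(cscale_lshift, cscale_rshift); ring.
  have := sub (cscale (cos b) (sin b) x) (r *: cscale (cos b) (sin b) x).
  under eq_integral do rewrite shift.
  (* The closed disc avoids 0: the real part 1 + r s is positive because s >= -1 and 0 < r < 1. *)
  apply=> s t st1 /=; apply/eqP; rewrite shift; apply: cscale_neq0 => //.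
  apply/eqP => -[e1 e2].
  have : (1 + r * s) ^+ 2 + (r * t) ^+ 2 = 0.
    transitivity (((1 + r * s) * cos b - r * t * sin b) ^+ 2 +
      ((1 + r * s) * sin b + r * t * cos b) ^+ 2).
      by have := cos2sin2 b => e; ring: e.
    by rewrite e1 e2 expr0n addr0.
  apply/eqP; rewrite gt_eqF // ltr_wpDr ?sqr_ge0 // exprn_gt0 //.
  have : s ^+ 2 <= 1 by have := sqr_ge0 t; lra.
  move=> s2; have s1 : -1 <= s; nra.
Qed.

End Line.

(** * Reading off the bidegree *)

Theorem theorem3p1 (R : realType) (d : nat) (rho : rpoly R)
    (rho_homog : rho \is d.-homog)
    (rho_pos : forall x : C2 R, x != 0 -> 0 < peval rho x)
    (u_psh : plurisubharmonic (~` [set 0 : C2 R]) (fun x => ln (peval rho x)))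
    (u_MA : vanishes_on (~` [set 0 : C2 R])
       (wedge (ddc (fun x => ln (peval rho x)))
              (ddc (fun x => ln (peval rho x))))) :
  exists k : nat, d = k.*2 /\ bihomogeneous k k rho.
Proof.
(* For odd [d], rho would take opposite signs at [e] and at its antipode. *)
have d_even : ~~ odd d.
  apply/negP => d_odd; pose e : C2 R := const_mx 1.
  have e0 : e != 0.
    apply/eqP => /rowP/(_ ord0); rewrite !mxE; exact/eqP/oner_neq0.
  have Ne0 : (-1) *: e != 0 by rewrite scaler_eq0 oppr_eq0 oner_eq0.
  have := rho_pos _ Ne0; rewrite (peval_scale _ _ rho_homog) -signr_odd d_odd.
  by rewrite expr1 mulN1r oppr_gt0 ltNge ltW // rho_pos.
exists d./2; split; first by rewrite even_halfK.
(* The angle of [cis_balanced]: every multiple of it by 1, ..., [d] lies strictly between 0 and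
   pi. *)
pose t : R := pi / d.+1%:R.
have t_itv : 0 <= t <= pi.
  by rewrite divr_ge0 ?pi_ge0 //= ler_pdivrMr // ler_peMr ?pi_ge0 // ler1n.
move=> m m_rho.
set l1 := (\sum_(j < 2) m (lshift 2 j))%N; set l2 := (\sum_(j < 2) m (rshift 2 j))%N.
(* The total degree is read off from the dilation by 2. *)
have l12 : (l1 + l2 = d)%N.
  have dil x : peval rho (cscale 2 0 x) = 2 ^+ d * peval rho x.
    by rewrite cscale_real (peval_scale _ _ rho_homog).
  have := mcoeff_in_zzbar_eigen dil m_rho.
  rewrite oppr0 -exprD -[Complex 2 0]/(real_complex R 2) -rmorphXn => /complexI/eqP.
  by rewrite -!natrX eqr_nat eqn_exp2l // => /eqP.
have rot x : peval rho (cscale (cos t) (sin t) x) = 1 * peval rho x.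
  by rewrite mul1r; exact: (psh_log_rotation_invariant rho_homog).
have l1E : l1 = l2.
  apply: (@cis_balanced R d) => //.
  by rewrite cisN; exact: (mcoeff_in_zzbar_eigen rot m_rho).
by move: l12; rewrite -l1E addnn => <-; rewrite doubleK.
Qed.
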